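(* Let $f_0,f_1$ be two spectral density functions and let $$f_\tau(\theta)=f_0(\theta)\left(\frac{f_1(\theta)}{f_0(\theta)}\right)^\tau,\qquad \tau\in[0,1],$$ be the logarithmic interval connecting them. With $x_\tau=\log f_\tau$ and $\dot x_\tau=\partial x_\tau/\partial\tau$, the logarithm $x_\tau(\theta)=\log f_0(\theta)+\tau(\log f_1(\theta)-\log f_0(\theta))$ is a linear function of $\tau$, the derivative $\dot x_\tau(\theta)=\log f_1(\theta)-\log f_0(\theta)$ is independent of $\tau$, and the logarithmic interval satisfies the geodesic condition that $$\frac{\dot{x}_\tau(\theta)-\left(\frac{1}{2\pi}\int_{-\pi}^{\pi}\dot{x}_\tau(\theta)\,d\theta\right)}{\sqrt{\frac{1}{2\pi}\int_{-\pi}^{\pi}\left(\dot{x}_\tau(\theta)\right)^2d\theta-\left(\frac{1}{2\pi}\int_{-\pi}^{\pi}\dot{x}_\tau(\theta)\,d\theta\right)^2}}$$ be independent of $\tau$.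
   Context: Spectral density functions are taken in the set $\mathcal{F}$ of functions $f$ that are differentiable on $[-\pi,\pi]$, with $f(\theta)>0$, and with both $f(\theta)$ and $df(\theta)/d\theta$ square integrable; throughout, all functions are assumed smooth enough so that the indicated integrals exist. The geodesic condition is the condition derived from the Euler-Lagrange equations for extremals of the path length $$\ell(f_\tau:0,1)=\int_0^1\sqrt{\frac{1}{2\pi}\int_{-\pi}^{\pi}\left(\dot x_\tau(\theta)\right)^2d\theta-\left(\frac{1}{2\pi}\int_{-\pi}^{\pi}\dot x_\tau(\theta)\,d\theta\right)^2}\;d\tau$$ among paths $f_\tau$ of spectral density functions connecting $f_0$ and $f_1$. *)

(* Defs.v *)
From HB Require Import structures.
From mathcomp Require Import all_boot all_order all_algebra.
From mathcomp Require Import all_classical all_reals all_analysis.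

Set Implicit Arguments.
Unset Strict Implicit.
Unset Printing Implicit Defensive.

Import Order.TTheory GRing.Theory Num.Theory.
Import numFieldNormedType.Exports.

Local Open Scope classical_set_scope.
Local Open Scope ring_scope.

(* Derivatives are relative to a subset D of the line, so that they are
   one-sided at the endpoints of a closed interval and never depend on the
   values of the function outside D. *)
Definition diff_quotient (R : realType) (f : R -> R) (x y : R) : R :=
  (f y - f x) / (y - x).

Definition differentiable_on (R : realType) (D : set R) (f : R -> R) : Prop :=
  forall x, D x -> cvg (diff_quotient f x y @[y --> within D x^']).

(* Meaningful only where the limit exists: see [differentiable_on]. *)
Definition deriv_on (R : realType) (D : set R) (f : R -> R) (x : R) : R :=
  lim (diff_quotient f x y @[y --> within D x^']).

Definition freq_band (R : realType) : set R := `[- pi, pi]%classic.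
Arguments freq_band : clear implicits.

Definition unit_itv (R : realType) : set R := `[0, 1]%classic.
Arguments unit_itv : clear implicits.

Definition square_integrable (R : realType) (D : set R) (f : R -> R) : Prop :=
  f \_ D \in Lfun (@lebesgue_measure R) 2%:E.

Definition spectral_density (R : realType) (f : R -> R) : Prop :=
  [/\ differentiable_on (freq_band R) f,
      forall theta, freq_band R theta -> 0 < f theta,
      square_integrable (freq_band R) f &
      square_integrable (freq_band R) (deriv_on (freq_band R) f)].

Definition mean (R : realType) (g : R -> R) : R :=
  (2 * pi)^-1 * \int[@lebesgue_measure R]_(theta in freq_band R) g theta.

(* A path tau |-> f_tau is a function f : R -> R -> R of tau, then theta;
   only its values for tau in [0, 1] and theta in [- pi, pi] matter. *)
Definition log_path (R : realType) (f : R -> R -> R) (tau theta : R) : R :=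
  ln (f tau theta).

Definition log_velocity (R : realType) (f : R -> R -> R) (tau theta : R) : R :=
  deriv_on (unit_itv R) (fun t => log_path f t theta) tau.

Definition speed (R : realType) (f : R -> R -> R) (tau : R) : R :=
  Num.sqrt (mean (fun theta => log_velocity f tau theta ^+ 2)
            - mean (log_velocity f tau) ^+ 2).

(* The speed vanishes exactly when the log-velocity is a.e. constant in theta;
   the quotient is then 0 by the convention x / 0 = 0. *)
Definition normalized_velocity (R : realType) (f : R -> R -> R)
    (tau theta : R) : R :=
  (log_velocity f tau theta - mean (log_velocity f tau)) / speed f tau.

(* The first two clauses ensure that the derivatives and the integrals in
   [normalized_velocity] exist. *)
Definition geodesic_condition (R : realType) (f : R -> R -> R) : Prop :=
  [/\ forall theta, freq_band R theta ->
        differentiable_on (unit_itv R) (fun t => log_path f t theta),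
      forall tau, unit_itv R tau ->
        square_integrable (freq_band R) (log_velocity f tau) &
      forall theta tau tau', freq_band R theta ->
        unit_itv R tau -> unit_itv R tau' ->
        normalized_velocity f tau theta = normalized_velocity f tau' theta].

Definition log_interval (R : realType) (f0 f1 : R -> R) (tau theta : R) : R :=
  f0 theta * (f1 theta / f0 theta) `^ tau.

(* Main.v *)
(** Since log f_tau is affine in tau, its tau-derivative does not depend on tau, so
    neither does the normalized velocity.  What needs an argument is that the
    velocity log f1 - log f0 is square integrable: f0 and f1 are differentiable,
    hence continuous, and positive on a compact interval, so their logarithms are
    continuous there. *)

Require Import Defs.
From mathcomp Require Import all_boot all_order all_algebra.
From mathcomp Require Import all_classical all_reals all_analysis.
Import Order.TTheory GRing.Theory Num.Theory.
Import numFieldNormedType.Exports.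

Local Open Scope ring_scope.
Local Open Scope classical_set_scope.

(** Points of the interval accumulate at [x] from the right if [x < b], and otherwise from the left,
    where [a < b <= x] leaves room. *)
Lemma limit_point_itvcc (R : realType) (a b x : R) :
  a < b -> a <= x <= b -> limit_point `[a, b] x.
Proof.
move=> ab /andP[ax xb] U xU.
have [xb'|bx] := ltP x b.
  near x^'+ => y; exists y; split; last first.
  - by near: y; exact: cvg_within xU.
  - rewrite /= in_itv/= (le_trans ax) /=; last by near: y; exact: nbhs_right_ge.
    by near: y; exact: nbhs_right_le.
  - by rewrite gt_eqF//; near: y; exact: nbhs_right_gt.
have ax' : a < x by exact: lt_le_trans bx.
near x^'- => y; exists y; split; last first.
- by near: y; exact: cvg_within xU.
- rewrite /= in_itv/= (le_trans _ xb) ?andbT; last by near: y; exact: nbhs_left_le.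
  by near: y; exact: nbhs_left_ge.
- by rewrite lt_eqF//; near: y; exact: nbhs_left_lt.
Unshelve. all: by end_near. Qed.

(** Properness of this filter makes limits along it unique, so that the [lim] in [deriv_on] can be
    computed from a convergence proof. *)
Lemma within_dnbhs_proper (T : topologicalType) (D : set T) (x : T) :
  limit_point D x -> ProperFilter (within D x^').
Proof.
move=> Dx; apply: Build_ProperFilter_ex => P.
rewrite /within/= /dnbhs/within/= => nP.
by have [y [yx Dy Py]] := Dx _ nP; exists y; apply: Py.
Qed.

(** At every point of [D] other than [x] the difference quotient is exactly [b]. *)
Lemma cvg_diff_quotient_affine (R : realType) (D : set R) (f : R -> R)
    (a b x : R) :
  D x -> (forall t, D t -> f t = a + t * b) ->
  diff_quotient f x y @[y --> within D x^'] --> b.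
Proof.
move=> Dx fE; apply: (@cvg_trans _ (cst b y @[y --> within D x^'])).
  apply: near_eq_cvg; rewrite near_withinE.
  near=> y => Dy; rewrite /diff_quotient !fE//=.
  rewrite opprD addrACA subrr add0r -mulrBl mulrAC divff ?mul1r//.
  by rewrite subr_eq0; near: y; exact: nbhs_dnbhs_neq.
exact: cvg_cst.
Unshelve. all: by end_near. Qed.

Lemma deriv_on_affine (R : realType) (D : set R) (f : R -> R) (a b x : R) :
  D x -> limit_point D x -> (forall t, D t -> f t = a + t * b) ->
  deriv_on D f x = b.
Proof.
move=> Dx lx fE; have PF := within_dnbhs_proper _ _ _ lx.
exact: cvg_lim (cvg_diff_quotient_affine _ _ _ _ _ _ Dx fE).
Qed.

(** For [y != x] in [D], [f y] is [f x] plus the difference quotient times [y - x]; the quotient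
    converges and [y - x] tends to 0. *)
Lemma differentiable_on_continuous (R : realType) (D : set R) (f : R -> R) :
  differentiable_on D f -> {within D, continuous f}.
Proof.
move=> df; apply/subspace_continuousP => x Dx.
have /cvg_ex[l fl] := df x Dx.
have cf : f y @[y --> within D x^'] --> f x.
  have -> : f x = f x + l * (x - x) by rewrite subrr mulr0 addr0.
  apply: (@cvg_trans _ ((f x + diff_quotient f x y * (y - x)) @[y --> within D x^'])).
    apply: near_eq_cvg; rewrite near_withinE; near=> y => Dy.
    rewrite /diff_quotient divfK ?subrKC// subr_eq0.
    by near: y; exact: nbhs_dnbhs_neq.
  apply: cvgD; first exact: cvg_cst.
  apply: cvgM => //; apply: cvgB; last exact: cvg_cst.
  by apply: cvg_trans (@nbhs_dnbhs _ x); exact: cvg_within.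
(* Passage from the punctured neighbourhood to the full one: the missing point [y = x] is harmless
   because [U] is a neighbourhood of [f x]. *)
move=> U fxU; have fU : nbhs x (fun y => y != x -> D y -> U (f y)) by exact: cf.
change (nbhs x (fun y => D y -> U (f y))).
apply: filterS fU => y Uy Dy; have [->|yx] := eqVneq y x; first exact: nbhs_singleton.
exact: Uy.
Unshelve. all: by end_near. Qed.

(** The square of [f] is again continuous on the compact set [D], hence integrable there. *)
Lemma compact_square_integrable (R : realType) (D : set R) (f : R -> R) :
  compact D -> {within D, continuous f} -> square_integrable D f.
Proof.
move=> cD cf.
have mD : measurable D.
  apply: measurable_realfun.closed_measurable.
  exact: compact_closed (@norm_hausdorff _ _) cD.
have mf : measurable_fun D f.
  exact: measurable_realfun.subspace_continuous_measurable_fun.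
have cf2 : {within D, continuous (fun x => f x ^+ 2)}.
  apply: (@within_continuous_comp _ _ _ D f (fun y => y ^+ 2)) => //.
  by move=> y _; exact: exprn_continuous.
have /integrableP[_ f2_fin] := continuous_compact_integrable cD cf2.
rewrite /square_integrable inE/=; apply/andP; split.
  by rewrite inE; apply/(measurable_restrictT f mD).
(* The 2-norm is a power of the integral of the squared absolute value, so it is enough that this
   integral is finite. *)
rewrite inE/= /finite_norm unlock; apply: poweR_lty.
apply: le_lt_trans f2_fin.
rewrite [leRHS]integral_mkcond le_eqVlt; apply/predU1P; left.
apply: eq_integral => x _; rewrite /= !patchE.
(* [f \_ D] takes the value [point] outside [D]; it is convertible to [0]. *)
case: ifPn => _ /=; last by rewrite normr0 powR0.
by rewrite powR_mulrn// normrX.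
Qed.

(** This allows the formula for the velocity, valid only on the band, to be used under the
    integral. *)
Lemma eq_mean (R : realType) (f g : R -> R) :
  (forall x, freq_band R x -> f x = g x) -> mean f = mean g.
Proof.
move=> fg; rewrite /mean; congr (_ * _).
by apply: eq_Rintegral => x /set_mem; exact: fg.
Qed.

Lemma log_path_log_interval (R : realType) (f0 f1 : R -> R) (t x : R) :
  0 < f0 x -> 0 < f1 x ->
  log_path (log_interval f0 f1) t x = ln (f0 x) + t * (ln (f1 x) - ln (f0 x)).
Proof.
move=> f0x f1x; rewrite /log_path /log_interval lnM ?posrE//.
  by rewrite ln_powR ln_div.
by rewrite powR_gt0// divr_gt0.
Qed.

Lemma continuous_ln_comp (R : realType) (D : set R) (f : R -> R) :
  (forall x, D x -> 0 < f x) -> {within D, continuous f} ->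
  {within D, continuous (fun x => ln (f x))}.
Proof.
move=> f0 cf; apply: (@within_continuous_comp _ _ _ D f (@ln R)) => //.
by move=> _ /set_mem[x Dx <-]; exact/continuous_ln/f0.
Qed.

Theorem mainTheorem6 (R : realType) (f0 f1 : R -> R)
    (hf0 : spectral_density f0) (hf1 : spectral_density f1) :
  [/\ forall tau theta : R, unit_itv R tau -> freq_band R theta ->
        log_path (log_interval f0 f1) tau theta
        = ln (f0 theta) + tau * (ln (f1 theta) - ln (f0 theta)),
      forall tau theta : R, unit_itv R tau -> freq_band R theta ->
        log_velocity (log_interval f0 f1) tau theta
        = ln (f1 theta) - ln (f0 theta) &
      geodesic_condition (log_interval f0 f1)].
Proof.
have [df0 f0_gt0 _ _] := hf0; have [df1 f1_gt0 _ _] := hf1.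
have pathE theta : freq_band R theta -> forall t,
    log_path (log_interval f0 f1) t theta
    = ln (f0 theta) + t * (ln (f1 theta) - ln (f0 theta)).
  by move=> th t; apply: log_path_log_interval; [exact: f0_gt0|exact: f1_gt0].
have velE tau theta : unit_itv R tau -> freq_band R theta ->
    log_velocity (log_interval f0 f1) tau theta = ln (f1 theta) - ln (f0 theta).
  move=> ut th; apply: deriv_on_affine => //.
    by apply: limit_point_itvcc.
  by move=> t _; exact: pathE.
split=> [tau theta _ th| //|]; first exact: pathE.
split=> [theta th tau ut|tau ut|theta tau tau' th ut ut'].
- apply/cvg_ex; exists (ln (f1 theta) - ln (f0 theta)).
  by apply: cvg_diff_quotient_affine => // t _; exact: pathE.
- apply: compact_square_integrable; first exact: segment_compact.
  (* Outside the band [f0] and [f1] may fail to be positive, so the velocity is replaced by the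
     difference of logarithms on the band only; continuity within the band sees no more. *)
  apply: (@subspace_eq_continuous _ _ _ (fun theta => ln (f1 theta) - ln (f0 theta))).
    by move=> theta /set_mem th; rewrite /= /from_subspace velE.
  by apply: within_continuousB; apply: continuous_ln_comp => //;
    exact: differentiable_on_continuous.
(* Once both means are expressed through [v], the two sides are the same expression, so a vanishing
   speed needs no separate case. *)
- pose v x := ln (f1 x) - ln (f0 x).
  have m1 t : unit_itv R t ->
      mean (log_velocity (log_interval f0 f1) t) = mean v.
    by move=> ht; apply: eq_mean => x Dx; rewrite velE.
  have m2 t : unit_itv R t ->
      mean (fun x => log_velocity (log_interval f0 f1) t x ^+ 2)
      = mean (fun x => v x ^+ 2).
    by move=> ht; apply: eq_mean => x Dx; rewrite velE.
  rewrite /normalized_velocity /speed (velE _ _ ut th) (velE _ _ ut' th).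
  by rewrite (m1 _ ut) (m1 _ ut') (m2 _ ut) (m2 _ ut').
Qed.
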